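(* For all $j\ge2$, $1\le r\le\infty$ and $s<j-1$ there exists an NLS-like equation, i.e. a choice of coefficients $c_{k,\alpha,b}\in\mathbb{R}$ (for $1\le k\le j$, $\alpha\in\mathbb{N}_0^{2k+1}$ with $|\alpha|=2(j-k)$, $b\in\{+,-\}^{2k+1}$) in $$i\partial_tu+(-1)^{j+1}\partial_x^{2j}u=\sum_{k=1}^{j}\ \sum_{\substack{b\in\{\pm\}^{2k+1}\\ \alpha\in\mathbb{N}_0^{2k+1},\ |\alpha|=2(j-k)}}c_{k,\alpha,b}\ \partial_x^{\alpha_1}v_{b_1}\prod_{\ell=1}^{k}\partial_x^{\alpha_{2\ell}}v_{b_{2\ell}}\,\partial_x^{\alpha_{2\ell+1}}v_{b_{2\ell+1}},\qquad v_+=u,\ v_-=\overline{u},$$ such that for the Cauchy problem for this equation with $u(t=0)=u_0$, $x\in\mathbb{T}$, the flow map $S:\hat H^s_r(\mathbb{T})\times(-T,T)\to\hat H^s_r(\mathbb{T})$ (for any $T>0$) cannot be uniformly continuous on bounded subsets.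
   Context: $\mathbb{T}=\mathbb{R}/2\pi\mathbb{Z}$, $\langle k\rangle=(1+k^2)^{1/2}$, $\frac1r+\frac1{r'}=1$. $\hat H^s_r(\mathbb{T})$ is the space of periodic distributions $u$ with $\|u\|_{\hat H^s_r}=\|\langle k\rangle^s\hat u(k)\|_{\ell^{r'}_k(\mathbb{Z})}<\infty$, where $\hat u(k)$ are the Fourier coefficients. The flow map is the map $S(u_0,t)=u(\cdot,t)$, where $u$ is the solution with datum $u_0$; in particular it agrees with smooth classical solutions. Uniform continuity on bounded subsets is understood with respect to the data: for every bounded $B\subset\hat H^s_r(\mathbb{T})$ and $\varepsilon>0$ there is $\delta>0$ such that $u_0,v_0\in B$, $\|u_0-v_0\|_{\hat H^s_r}<\delta$ imply $\sup_{|t|<T}\|S(u_0,t)-S(v_0,t)\|_{\hat H^s_r}<\varepsilon$. The claim is that this fails. *)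

(* Defs.v *)
From HB Require Import structures.
From mathcomp Require Import all_boot all_order all_algebra.
From mathcomp Require Import all_classical all_reals all_analysis.
From mathcomp Require Import complex.

Set Implicit Arguments.
Unset Strict Implicit.
Unset Printing Implicit Defensive.

Import Order.TTheory GRing.Theory Num.Theory.
Import numFieldNormedType.Exports.
Import complex Normc.

Local Open Scope classical_set_scope.
Local Open Scope ring_scope.

HB.instance Definition _ := isPointed.Build int 0.
HB.instance Definition _ := @isMeasurable.Build default_measure_display
  int discrete_measurable discrete_measurable0
  discrete_measurableC discrete_measurableU.

Section ComplexValued.
Context {R : realType}.
Local Notation C := (R[i]).

(* Calculus with values in R[i] is componentwise: R[i] carries no
   normedModType structure over R. *)
Definition cderive (f : R -> C) : R -> C :=
  fun x => Complex (derive1 (@Re R \o f) x) (derive1 (@Im R \o f) x).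

Definition cderiven (n : nat) (f : R -> C) : R -> C := iter n cderive f.

Definition cderivable (f : R -> C) (x : R) : Prop :=
  derivable (@Re R \o f) x 1 /\ derivable (@Im R \o f) x 1.

Definition csmooth (f : R -> C) : Prop :=
  forall (n : nat) (x : R), cderivable (cderiven n f) x.

Definition cintegral (f : R -> C) : C :=
  Complex (\int[lebesgue_measure]_(x in `[0, pi *+ 2]) Re (f x))
          (\int[lebesgue_measure]_(x in `[0, pi *+ 2]) Im (f x)).

End ComplexValued.

(* C^oo functions on the torus R / 2 pi Z, as periodic functions on R *)
Record test (R : realType) := Test {
  test_fun :> R -> R[i];
  test_smooth : csmooth test_fun;
  test_periodic : periodic test_fun (pi *+ 2) }.

(* pairing_continuous is continuity for the Frechet topology of C^oo(T),
   written with its defining seminorms: |u phi| <= K max_(n <= N) |phi^(n)|. *)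
Record pdist (R : realType) := PDist {
  pairing :> test R -> R[i];
  pairing_linear : forall (a : R[i]) (phi psi chi : test R),
    (forall x, chi x = a * phi x + psi x) ->
    pairing chi = a * pairing phi + pairing psi;
  pairing_continuous : exists (N : nat) (K : R), forall (phi : test R) (M : R),
    (forall (n : nat) (x : R), (n <= N)%N -> normc (cderiven n phi x) <= M) ->
    normc (pairing phi) <= K * M }.

Section Fourier.
Context {R : realType}.
Local Notation C := (R[i]).

Definition cexpi (x : R) : C := Complex (cos x) (sin x).

Lemma is_derive_sinusoid (a b w x : R) :
  is_derive x 1 (fun y => a * cos (w * y) + b * sin (w * y))
    (b * w * cos (w * x) + - (a * w) * sin (w * x)).
Proof.
have dl : is_derive x 1 (fun y : R => w * y) w.
  have := is_deriveZ (f := id) w (is_derive_id x 1).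
  by rewrite /GRing.scale /= mulr1.
have dc := is_derive1_comp (is_derive_cos (w * x)) dl.
have ds := is_derive1_comp (is_derive_sin (w * x)) dl.
have D := is_deriveD (is_deriveZ a dc) (is_deriveZ b ds).
apply: (is_derive_eq D).
by rewrite /GRing.scale /= addrC mulNr mulrN mulNr !mulrA [_ * cos _ * _]mulrAC
  [_ * sin _ * _]mulrAC.
Qed.

Lemma cderiven_cexpi (k : R) n : exists a b c d : R,
  cderiven n (fun x => cexpi (k * x)) = fun x =>
  Complex (a * cos (k * x) + b * sin (k * x)) (c * cos (k * x) + d * sin (k * x)).
Proof.
elim: n => [|n [a [b [c [d IH]]]]].
  by exists 1, 0, 0, 1; apply/funext => x; rewrite /= !mul1r !mul0r addr0 add0r.
exists (b * k), (- (a * k)), (d * k), (- (c * k)).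
rewrite /cderiven iterS -/(cderiven n _) IH; apply/funext => x.
congr Complex; rewrite derive1E; apply: derive_val; exact: is_derive_sinusoid.
Qed.

Lemma csmooth_cexpi (k : R) : csmooth (fun x => cexpi (k * x)).
Proof.
move=> n x; have [a [b [c [d ->]]]] := cderiven_cexpi k n.
by split; apply: ex_derive; exact: is_derive_sinusoid.
Qed.

Lemma periodic_cexpi (k : int) : periodic (fun x : R => cexpi (k%:~R * x)) (pi *+ 2).
Proof.
suff H (n : nat) y : cexpi (y + n%:R * (pi *+ 2)) = cexpi y.
  move=> x; rewrite mulrDr; case: k => n; first exact: H.
  by rewrite -[LHS](H n.+1) NegzE mulrNz !mulNr -pmulrn subrK.
by rewrite /cexpi !mulr_natl (periodicn (@cosD2pi R)) (periodicn (@sinD2pi R)).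
Qed.

(* x |-> e^{ikx} *)
Definition character (k : int) : test R :=
  Test (csmooth_cexpi k%:~R) (periodic_cexpi k).

(* \hat u(k) = (1 / 2 pi) <u, e^{-ikx}>.  The argument is a bare functional so
   that differences of distributions can be taken pointwise. *)
Definition fourier (u : test R -> C) (k : int) : C :=
  u (character (- k)) / (pi *+ 2)%:C%C.

Definition japanese (k : int) : R := (1 + k%:~R ^+ 2) `^ 2^-1.

(* || <k>^s \hat u(k) ||_{l^{r'}_k(Z)} with r' the conjugate exponent of r *)
Definition hatnorm (s : R) (r : \bar R) (u : test R -> C) : \bar R :=
  Lnorm counting (hoelder_conjugate r)
    (fun k : int => (japanese k `^ s * normc (fourier u k))%:E).

Definition hatH (s : R) (r : \bar R) : Type :=
  {u : pdist R | (hatnorm s r u < +oo)%E}.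

(* the distribution u is the (continuous, 2 pi-periodic) function f *)
Definition represents (u : pdist R) (f : R -> C) : Prop :=
  forall phi : test R, u phi = cintegral (fun x => f x * phi x).

End Fourier.

Section NLS.
Context {R : realType}.
Local Notation C := (R[i]).

(* Index k stands for products of 2k+1 factors; since |alpha| = 2(j-k), each
   alpha_i is at most 2(j-k), which makes the index set finite.  The sign + is
   encoded by true. *)
Definition multi (j k : nat) := {ffun 'I_(2 * k + 1) -> 'I_(2 * (j - k) + 1)}.
Definition signs (k : nat) := {ffun 'I_(2 * k + 1) -> bool}.

Definition nls_coeff (j : nat) := forall k : nat, multi j k -> signs k -> R.

Definition signed (b : bool) (f : R -> C) : R -> C :=
  if b then f else fun x => (f x)^*%C.

Definition nls_nonlinearity (j : nat) (c : nls_coeff j) (f : R -> C) (x : R) : C :=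
  \sum_(1 <= k < j.+1)
    \sum_(b : signs k)
      \sum_(alpha : multi j k | (\sum_i alpha i == 2 * (j - k))%N)
        (c k alpha b)%:C%C *
        \prod_(i < 2 * k + 1) cderiven (alpha i) (signed (b i) f) x.

(* joint C^n regularity in (t, x) on the open strip {|t| < T} *)
Fixpoint jointC (T : R) (n : nat) (u : R -> R -> C) : Prop :=
  (forall t x, `|t| < T ->
     {for (t, x), continuous (fun p : R * R => Re (u p.1 p.2))} /\
     {for (t, x), continuous (fun p : R * R => Im (u p.1 p.2))}) /\
  if n is m.+1 then
    [/\ forall t x, `|t| < T -> cderivable (u ^~ x) t /\ cderivable (u t) x,
        jointC T m (fun t x => cderive (u ^~ x) t) &
        jointC T m (fun t x => cderive (u t) x)]
  else True.

Definition classical_solution (j : nat) (c : nls_coeff j) (T : R)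
    (u : R -> R -> C) : Prop :=
  [/\ forall n, jointC T n u,
      forall t, `|t| < T -> periodic (u t) (pi *+ 2) &
      forall t x, `|t| < T ->
        'i%C * cderive (u ^~ x) t + (- 1) ^+ j.+1 * cderiven (2 * j) (u t) x
        = nls_nonlinearity c (u t) x].

Variables (s : R) (r : \bar R).

(* Only the values S u0 t with |t| < T are used. *)
Definition flow_map (j : nat) (c : nls_coeff j) (T : R)
    (S : hatH s r -> R -> hatH s r) : Prop :=
  forall (u : R -> R -> C) (u0 : hatH s r),
    classical_solution c T u -> represents (sval u0) (u 0) ->
    forall t, `|t| < T -> represents (sval (S u0 t)) (u t).

Definition hatdist (u v : hatH s r) : \bar R :=
  hatnorm s r (fun phi => sval u phi - sval v phi).

Definition hat_bounded (B : set (hatH s r)) : Prop :=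
  exists M : R, forall u, B u -> (hatnorm s r (sval u) <= M%:E)%E.

Definition unif_cont_on_bounded (T : R) (S : hatH s r -> R -> hatH s r) : Prop :=
  forall (B : set (hatH s r)) (e : R), hat_bounded B -> 0 < e ->
  exists2 d : R, 0 < d &
    forall u0 v0, B u0 -> B v0 -> (hatdist u0 v0 < d%:E)%E ->
    (ereal_sup [set hatdist (S u0 t) (S v0 t) | t in [set t | `|t| < T]%R]
       < e%:E)%E.

End NLS.

Arguments nls_coeff R j : clear implicits.

(* Main.v *)
Require Import Defs.
From mathcomp Require Import all_boot all_order all_algebra.
From mathcomp Require Import all_classical all_reals all_analysis.
From mathcomp Require Import ess_sup_inf finmap complex ring lra.

(* Keep a single cubic term, so that the equation has the exact plane wave
   solutions u_a(t, x) = a J e^{i(n x - w_a t)}, where J = <n>^{-s} and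
   w_a = n^{2j} + n^{2(j-1)} J^2 a^2.  Their norm is |a|, whatever n, s and r.
   Since s < j - 1, the factor K = n^{2(j-1)} J^2 is unbounded in n.  Hence for
   b < 1 arbitrarily close to 1 the data u_1(0) and u_b(0) are at distance 1 - b,
   while for n large enough the phases have drifted apart by exactly pi at the
   time t = pi / (K (1 - b^2)) < T, where the distance is 1 + b. *)

Import Order.TTheory GRing.Theory Num.Theory.
Import numFieldNormedType.Exports.
Import complex Normc.

Local Open Scope classical_set_scope.
Local Open Scope ring_scope.

Section PlaneWaves.
Context {R : realType}.
Local Notation C := (R[i]).
Implicit Types (f g : R -> C) (l : C) (x y t : R).

(** * The complex exponential and the modulus *)

Lemma cexpi0 : cexpi 0 = 1 :> C.
Proof. by rewrite /cexpi cos0 sin0. Qed.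

Lemma cexpiD x y : cexpi (x + y) = cexpi x * cexpi y :> C.
Proof. by rewrite /cexpi cosD sinD; simpc; rewrite [sin x * _ + _]addrC. Qed.

Lemma cexpiN x : cexpi (- x) = ((cexpi x)^*)%C :> C.
Proof. by rewrite /cexpi cosN sinN. Qed.

Lemma cexpiDpi x : cexpi (x + pi) = - cexpi x :> C.
Proof. by rewrite /cexpi cosDpi sinDpi. Qed.

Lemma cexpiMN x : cexpi x * cexpi (- x) = 1 :> C.
Proof. by rewrite -cexpiD subrr cexpi0. Qed.

Lemma normc_nneg (z : C) : 0 <= normc z.
Proof. by case: z => ? ?; exact: sqrtr_ge0. Qed.

Lemma normc_cexpi x : normc (cexpi x : C) = 1.
Proof. by rewrite /= cos2Dsin2 sqrtr1. Qed.

Lemma normc_real x : 0 <= x -> normc (x%:C%C : C) = x.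
Proof. by move=> x0 /=; rewrite expr0n addr0 sqrtr_sqr ger0_norm. Qed.

(** * Derivatives and joint smoothness of waves *)

Lemma Re_wave l k : @Re R \o (fun x => l * cexpi (k * x)) =
  fun x => Re l * cos (k * x) + - Im l * sin (k * x).
Proof. by apply/funext => x; case: l => p q /=; rewrite mulNr. Qed.

Lemma Im_wave l k : @Im R \o (fun x => l * cexpi (k * x)) =
  fun x => Im l * cos (k * x) + Re l * sin (k * x).
Proof. by apply/funext => x; case: l => p q /=; rewrite addrC. Qed.

Lemma cderivable_wave l k x : cderivable (fun y => l * cexpi (k * y)) x.
Proof.
by split; rewrite ?Re_wave ?Im_wave; apply: ex_derive; exact: is_derive_sinusoid.
Qed.

Lemma cderive_wave l k : cderive (fun x => l * cexpi (k * x)) =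
  fun x => ('i%C * k%:C%C * l) * cexpi (k * x).
Proof.
have D p q x : derive1 (fun y => p * cos (k * y) + q * sin (k * y)) x =
    q * k * cos (k * x) + - (p * k) * sin (k * x).
  by rewrite derive1E; apply: derive_val; exact: is_derive_sinusoid.
apply/funext => x; rewrite /cderive Re_wave Im_wave !D.
by case: l => p q; rewrite /cexpi; simpc; congr Complex => /=; ring.
Qed.

Lemma cderiven_wave l k n : cderiven n (fun x => l * cexpi (k * x)) =
  fun x => (('i%C * k%:C%C) ^+ n * l) * cexpi (k * x).
Proof.
elim: n => [|n IH]; first by apply/funext => x; rewrite expr0 mul1r.
by rewrite /cderiven iterS -/(cderiven n _) IH cderive_wave exprS mulrA.
Qed.

(** As $(ik)^2 = -k^2$, an even number of derivatives multiplies a wave by a real factor. Only even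
    orders occur in the equation used below. *)
Lemma cderiven_wave_even l k n x :
  cderiven (2 * n) (fun x => l * cexpi (k * x)) x =
  ((-1) ^+ n * k ^+ (2 * n))%:C%C * (l * cexpi (k * x)).
Proof.
rewrite cderiven_wave mulrA exprMn exprM -[X in X ^+ n]/('i%C ^+ 2) sqr_i.
by rewrite rmorphM !rmorphXn rmorphN1.
Qed.

(** Both partial derivatives are again waves with the same [k] and [w], the amplitude being
    multiplied by $iw$ or $ik$. The induction on [n] therefore has to run over all [l]. *)
Lemma jointC_wave (T : R) n l k w :
  jointC T n (fun t x => l * cexpi (k * x) * cexpi (w * t)).
Proof.
have phase_cvg p : (fun q : R * R => k * q.2 + w * q.1) @ p --> k * p.2 + w * p.1.
  by apply: cvgD; (apply: cvgM; [exact: cvg_cst|]); [exact: cvg_snd|exact: cvg_fst].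
have cvgc p : (fun q : R * R => cos (k * q.2 + w * q.1)) @ p -->
    cos (k * p.2 + w * p.1).
  by apply: cvg_comp (phase_cvg p) _; exact: continuous_cos.
have cvgs p : (fun q : R * R => sin (k * q.2 + w * q.1)) @ p -->
    sin (k * p.2 + w * p.1).
  by apply: cvg_comp (phase_cvg p) _; exact: continuous_sin.
(* The two exponentials merge into one with phase [k * x + w * t], so joint continuity comes from
   that of the phase. *)
have joint_continuous l' :
    continuous (fun p : R * R => Re (l' * cexpi (k * p.2) * cexpi (w * p.1))) /\
    continuous (fun p : R * R => Im (l' * cexpi (k * p.2) * cexpi (w * p.1))).
  split => p.
    rewrite (_ : (fun _ => _) = fun q : R * R =>
        Re l' * cos (k * q.2 + w * q.1) - Im l' * sin (k * q.2 + w * q.1)).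
      by apply: cvgB; apply: cvgM; by [exact: cvg_cst|exact: cvgc|exact: cvgs].
    by apply/funext => q; rewrite -mulrA -cexpiD; case: l'.
  rewrite (_ : (fun _ => _) = fun q : R * R =>
      Re l' * sin (k * q.2 + w * q.1) + Im l' * cos (k * q.2 + w * q.1)).
    by apply: cvgD; apply: cvgM; by [exact: cvg_cst|exact: cvgc|exact: cvgs].
  by apply/funext => q; rewrite -mulrA -cexpiD; case: l'.
elim: n l => [|n IH] l; have [cRe cIm] := joint_continuous l.
  by split=> // t x _; split; [exact: (cRe (t, x))|exact: (cIm (t, x))].
split; first by move=> t x _; split; [exact: (cRe (t, x))|exact: (cIm (t, x))].
split.
- move=> t x _; split.
    exact: cderivable_wave.
  rewrite (_ : (fun _ => _) = fun x => (l * cexpi (w * t)) * cexpi (k * x)).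
    exact: cderivable_wave.
  by apply/funext => y; rewrite mulrAC.
- have := IH ('i%C * w%:C%C * l); congr jointC.
  by apply/funext => t; apply/funext => x; rewrite cderive_wave !mulrA.
- have := IH ('i%C * k%:C%C * l); congr jointC.
  apply/funext => t; apply/funext => x.
  rewrite (_ : (fun _ => _) = fun x => (l * cexpi (w * t)) * cexpi (k * x)).
    by rewrite cderive_wave mulrA [RHS]mulrAC.
  by apply/funext => y; rewrite mulrAC.
Qed.

(** * Integration of complex-valued functions over one period *)

Definition ccontinuous f : Prop :=
  continuous (@Re R \o f) /\ continuous (@Im R \o f).

Lemma ccontinuousM f g :
  ccontinuous f -> ccontinuous g -> ccontinuous (fun x => f x * g x).
Proof.
move=> [fr fi] [gr gi]; split=> x.
  rewrite (_ : _ \o _ = fun y => Re (f y) * Re (g y) - Im (f y) * Im (g y)).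
    by apply: cvgB; apply: cvgM; by [exact: fr|exact: fi|exact: gr|exact: gi].
  by apply/funext => y /=; case: (f y) (g y) => [? ?] [].
rewrite (_ : _ \o _ = fun y => Re (f y) * Im (g y) + Im (f y) * Re (g y)).
  by apply: cvgD; apply: cvgM; by [exact: fr|exact: fi|exact: gr|exact: gi].
by apply/funext => y /=; case: (f y) (g y) => [? ?] [].
Qed.

Lemma cderivable_ccontinuous f : (forall x, cderivable f x) -> ccontinuous f.
Proof.
by move=> df; split=> x; apply: differentiable_continuous; apply/derivable1_diffP;
  have [] := df x.
Qed.

Lemma ccontinuous_test (phi : test R) : ccontinuous phi.
Proof. by apply: cderivable_ccontinuous => x; exact: (test_smooth phi 0). Qed.

Lemma ccontinuous_wave l k : ccontinuous (fun x => l * cexpi (k * x)).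
Proof. by apply: cderivable_ccontinuous => x; exact: cderivable_wave. Qed.

Lemma twopi_gt0 : 0 < pi *+ 2 :> R.
Proof. by rewrite pmulrn_lgt0// pi_gt0. Qed.

Lemma continuous_integrable_itv h (u v : R) : continuous h ->
  lebesgue_measure.-integrable `[u, v] (EFin \o h).
Proof.
move=> ch; apply: continuous_compact_integrable; first exact: segment_compact.
exact: continuous_subspaceT.
Qed.

Lemma cintegral_linear a f g : ccontinuous f -> ccontinuous g ->
  cintegral (fun x => a * f x + g x) = a * cintegral f + cintegral g.
Proof.
move=> [fr fi] [gr gi].
(* Each component of [a * f x + g x] is a real combination of three real functions, whose
   coefficients are, up to sign, the components of [a]. *)
have lin (p q : R) h1 h2 h3 : continuous h1 -> continuous h2 -> continuous h3 ->
    \int[lebesgue_measure]_(x in `[0, pi *+ 2]) (p * h1 x + q * h2 x + h3 x) =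
    p * \int[lebesgue_measure]_(x in `[0, pi *+ 2]) h1 x +
    q * \int[lebesgue_measure]_(x in `[0, pi *+ 2]) h2 x +
    \int[lebesgue_measure]_(x in `[0, pi *+ 2]) h3 x.
  move=> c1 c2 c3.
  have cZ (b : R) h : continuous h -> continuous (fun x => b * h x).
    by move=> ch x; apply: cvgM; [exact: cvg_cst|exact: ch].
  have cD : continuous (fun x => p * h1 x + q * h2 x).
    by move=> x; apply: cvgD; exact: cZ.
  rewrite RintegralD//; try exact: continuous_integrable_itv.
  rewrite RintegralD//; try (apply: continuous_integrable_itv; exact: cZ).
  by rewrite !RintegralZl//; exact: continuous_integrable_itv.
case: a => p q; rewrite /cintegral; simpc; congr Complex.
  rewrite -mulNr -lin//; apply: eq_Rintegral => x _.
  by case: (f x) (g x) => [? ?] [? ?] /=; ring.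
rewrite -lin//; apply: eq_Rintegral => x _.
by case: (f x) (g x) => [? ?] [? ?] /=; ring.
Qed.

Lemma normc_le_ReIm (z : C) : normc z <= `|Re z| + `|Im z|.
Proof.
case: z => p q /=; rewrite -[leRHS]ger0_norm ?addr_ge0// -sqrtr_sqr.
apply: ler_wsqrtr; rewrite sqrrD !real_normK ?num_real// lerD2r lerDl.
by rewrite mulrn_wge0 ?mulr_ge0.
Qed.

Lemma normc_ge_ReIm (z : C) : `|Re z| <= normc z /\ `|Im z| <= normc z.
Proof.
case: z => p q /=; rewrite -!sqrtr_sqr; split; apply: ler_wsqrtr.
  by rewrite lerDl sqr_ge0.
by rewrite lerDr sqr_ge0.
Qed.

Lemma Rintegral_cst_torus (M : R) :
  \int[lebesgue_measure]_(x in `[0, pi *+ 2]) M = pi *+ 2 * M.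
Proof.
have itv_length : lebesgue_measure (`[0, pi *+ 2]%classic : set R) = (pi *+ 2)%:E.
  by rewrite lebesgue_measure_itv/= lte_fin twopi_gt0 -EFinD subr0.
rewrite Rintegral_cst// mulrC; congr (_ * _); exact: (congr1 fine itv_length).
Qed.

(** Each component of the integral is at most $2\pi M$, and the modulus is at most the sum of the
    two; this crude bound gives $4\pi$ instead of $2\pi$. *)
Lemma normc_cintegral_le f (M : R) : ccontinuous f ->
  (forall x, normc (f x) <= M) -> normc (cintegral f) <= pi *+ 4 * M.
Proof.
move=> [fr fi] fM.
have bound h : continuous h -> (forall x, `|h x| <= M) ->
    `|\int[lebesgue_measure]_(x in `[0, pi *+ 2]) h x| <= pi *+ 2 * M.
  move=> ch hM; apply: (le_trans (le_normr_Rintegral _ _)) => //.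
    exact: continuous_integrable_itv.
  have -> : pi *+ 2 * M = \int[lebesgue_measure]_(x in `[0, pi *+ 2 : R]) M.
    by rewrite Rintegral_cst_torus.
  apply: le_Rintegral => //.
    by apply: continuous_integrable_itv => x; apply: cvg_norm; exact: ch.
  by apply: continuous_integrable_itv => x; exact: cvg_cst.
apply: (le_trans (normc_le_ReIm _)).
rewrite (_ : pi *+ 4 * M = pi *+ 2 * M + pi *+ 2 * M); last by ring.
by apply: lerD; apply: bound => // x; have [? ?] := normc_ge_ReIm (f x);
  exact: le_trans (fM x).
Qed.

(** The antiderivative [F], available since [m] is nonzero, takes the same value at both ends of the
    period. The end values of cosine and sine are read off from [periodic_cexpi] at 0. *)
Lemma Rintegral_sinusoid (p q : R) (m : int) : m != 0 ->
  \int[lebesgue_measure]_(x in `[0, pi *+ 2])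
    (p * cos (m%:~R * x) + q * sin (m%:~R * x)) = 0.
Proof.
move=> m0; have mR0 : m%:~R != 0 :> R by rewrite intr_eq0.
pose F x : R := - (q / m%:~R) * cos (m%:~R * x) + (p / m%:~R) * sin (m%:~R * x).
have dF x : is_derive x 1 F (p * cos (m%:~R * x) + q * sin (m%:~R * x)).
  by apply: is_derive_eq (is_derive_sinusoid _ _ _ x) _; field.
have cont (b c : R) : continuous (fun x => b * cos (m%:~R * x) + c * sin (m%:~R * x)).
  move=> x; apply: differentiable_continuous; apply/derivable1_diffP.
  by apply: ex_derive; exact: is_derive_sinusoid.
rewrite /Rintegral (@continuous_FTC2 _ _ F).
- rewrite -EFinB /= /F !mulr0 cos0 sin0.
  have /(congr1 (@Re R)) /= := @periodic_cexpi R m 0.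
  have /(congr1 (@Im R)) /= := @periodic_cexpi R m 0.
  by rewrite add0r !mulr0 cos0 sin0 => -> ->; rewrite mulr0 subrr.
- exact: twopi_gt0.
- by apply: continuous_subspaceT; exact: cont.
- split.
  + by move=> x _; apply: ex_derive; exact: dF.
  + by apply: cvg_at_right_filter; exact: cont.
  + by apply: cvg_at_left_filter; exact: cont.
- by move=> x _; rewrite derive1E; apply: derive_val; exact: dF.
Qed.

(** Orthogonality of the characters, from which the Fourier coefficients of a wave follow. *)
Lemma cintegral_wave l (m : int) : cintegral (fun x => l * cexpi (m%:~R * x)) =
  if m == 0 then (pi *+ 2)%:C%C * l else 0.
Proof.
have Re_w x : Re (l * cexpi (m%:~R * x)) = _ := congr1 (@^~ x) (Re_wave l m%:~R).
have Im_w x : Im (l * cexpi (m%:~R * x)) = _ := congr1 (@^~ x) (Im_wave l m%:~R).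
rewrite /cintegral; case: eqVneq => [->|m0]; last first.
  under eq_Rintegral do rewrite Re_w.
  under [X in Complex _ X]eq_Rintegral do rewrite Im_w.
  by rewrite !Rintegral_sinusoid.
have E x : l * cexpi (0%:~R * x) = l by rewrite mul0r cexpi0 mulr1.
under eq_Rintegral do rewrite E; under [X in Complex _ X]eq_Rintegral do rewrite E.
rewrite !Rintegral_cst_torus; case: l {Re_w Im_w E} => p q; by simpc.
Qed.

(** * Waves as periodic distributions *)

Lemma pairing_linear_of_continuous f : ccontinuous f ->
  forall (a : C) (phi psi chi : test R),
    (forall x, chi x = a * phi x + psi x) ->
    cintegral (fun x => f x * chi x) =
    a * cintegral (fun x => f x * phi x) + cintegral (fun x => f x * psi x).
Proof.
move=> cf a phi psi chi chiE; rewrite -cintegral_linear//.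
- congr cintegral; apply/funext => x; rewrite chiE; ring.
- by apply: ccontinuousM => //; exact: ccontinuous_test.
- by apply: ccontinuousM => //; exact: ccontinuous_test.
Qed.

Lemma pairing_continuous_of_bounded f (B : R) : ccontinuous f ->
    (forall x, normc (f x) <= B) ->
  exists (N : nat) (K : R), forall (phi : test R) (M : R),
    (forall (n : nat) (x : R), (n <= N)%N -> normc (cderiven n phi x) <= M) ->
    normc (cintegral (fun x => f x * phi x)) <= K * M.
Proof.
(* A bounded function is a distribution of order 0: the supremum of [phi] alone controls the
   pairing. *)
move=> cf fB; exists 0%N, (pi *+ 4 * B) => phi M phiM; rewrite -mulrA.
apply: normc_cintegral_le.
  by apply: ccontinuousM => //; exact: ccontinuous_test.
move=> x; rewrite normcM; apply: ler_pM; rewrite ?normc_nneg//.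
exact: (phiM 0%N x).
Qed.

Lemma normc_wave l k x : normc (l * cexpi (k * x)) <= normc l.
Proof. by rewrite normcM normc_cexpi mulr1. Qed.

Definition wave_dist l k : pdist R :=
  PDist (pairing_linear_of_continuous _ (ccontinuous_wave l k))
    (pairing_continuous_of_bounded _ _ (ccontinuous_wave l k) (normc_wave l k)).

Lemma wave_distP l k : represents (wave_dist l k) (fun x => l * cexpi (k * x)).
Proof. by []. Qed.

(** * Fourier coefficients and norms of a single mode *)

Lemma fourier_wave (u : pdist R) l (n : int) :
  represents u (fun x => l * cexpi (n%:~R * x)) ->
  forall m, fourier u m = if m == n then l else 0.
Proof.
move=> uE m; rewrite /fourier uE /=.
rewrite (_ : (fun x => _) = fun x => l * cexpi ((n - m)%:~R * x)); last first.
  apply/funext => x; rewrite -mulrA -cexpiD; congr (_ * cexpi _).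
  by rewrite rmorphB/= rmorphN/= mulrBl mulNr.
rewrite cintegral_wave subr_eq0 eq_sym; case: eqVneq => _; last by rewrite mul0r.
by rewrite mulrAC divff ?mul1r// eq_complex /= eqxx andbT gt_eqF// twopi_gt0.
Qed.

Lemma counting_set1 (n : int) : (counting : {measure set int -> \bar R}) [set n] = 1%E.
Proof.
rewrite /= /counting asboolT; last exact: finite_set1.
by rewrite fset_set1 cardfs1.
Qed.

(** A sequence supported at one point has the same norm in every $\ell^p$, which is what makes the
    argument uniform in [r]. For finite [p] the integrand is a multiple of an indicator; the
    infinite exponent goes through the essential supremum. *)
Lemma Lnorm_counting_single (p : \bar R) (n : int) (a : R) : (0 < p)%E -> 0 <= a ->
  Lnorm (@counting int R) p (fun m => (if m == n then a else 0)%:E) = a%:E.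
Proof.
move=> p0 a0; rewrite unlock; case: p p0 => [p| |//].
  rewrite lte_fin => p0.
  transitivity ((\int[@counting int R]_m ((a `^ p)%:E * (\1_[set n] m)%:E)) `^ p^-1)%E.
    congr (_ `^ _)%E; apply: eq_integral => m _; rewrite indicE in_set1.
    case: eqVneq => _ /=; first by rewrite ger0_norm// mule1.
    by rewrite normr0 powR0 ?gt_eqF// mule0.
  rewrite ge0_integralZl//; last by rewrite lee_fin powR_ge0.
  rewrite integral_indic// setIT counting_set1 mule1 poweR_EFin -powRrM.
  by rewrite divff ?powRr1// gt_eqF.
(* A set containing [n] has measure at least 1, so no null set contains [n] and the value [a] cannot
   be discarded by the essential supremum. *)
have le_counting (A : set int) : A n -> (1 <= (counting : {measure set int -> \bar R}) A)%E.
  move=> An; rewrite -(counting_set1 n); apply: le_measure; try exact: mem_set.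
  by move=> _ ->.
(* The norm with infinite exponent is 0 by convention on a space of measure zero; that case is
   excluded here. *)
move=> _; rewrite ifT; last by apply: lt_le_trans (le_counting setT I).
apply/eqP; rewrite eq_le; apply/andP; split.
  apply/ess_supP; apply: nearW => m /=; case: eqVneq => _; rewrite lee_fin.
    by rewrite ger0_norm.
  by rewrite normr0.
have [N [mN N0 subN]] := ess_sup_ge (@counting int R)
  (abse \o fun m => (if m == n then a else 0)%:E).
have nN : ~ N n by move=> /le_counting; rewrite N0 lee_fin ler10.
have := contra_not (@subN n) nN; rewrite not_notE => /=.
by rewrite eqxx ger0_norm.
Qed.

(** Stated for a bare functional so that it also covers differences of distributions. *)
Lemma hatnorm_single (s : R) (r : \bar R) (u : test R -> C) l (n : int) : (1 <= r)%E ->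
  (forall m, fourier u m = if m == n then l else 0) ->
  hatnorm s r u = (japanese n `^ s * normc l)%:E.
Proof.
move=> r1 uE; rewrite /hatnorm -(@Lnorm_counting_single (hoelder_conjugate r) n).
- apply: eq_Lnorm => m; rewrite uE; case: eqVneq => [->//|_].
  by rewrite normc0 mulr0.
- exact: lt_le_trans (hoelder_conj_ge1 r1).
- by rewrite mulr_ge0 ?powR_ge0 ?normc_nneg.
Qed.

(** With $z = 1 + n^2$ and $n \ge 1$ one has $n^2 \ge z/2$, so the product is at least $2^{-m}
    z^{m-s}$, whose exponent is positive. *)
Lemma frequency_growth (m : nat) (s K : R) : s < m%:R ->
  exists2 n : nat, (0 < n)%N & K < n%:R ^+ (2 * m) * (japanese n%:Z `^ (- s)) ^+ 2.
Proof.
move=> sm; set e := m%:R - s; have e0 : 0 < e by rewrite subr_gt0.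
(* The factor $2^m$ pays for the loss in $n^2 \ge z/2$, and [|K| + 1] is positive and exceeds [K]
   whatever its sign. The successor in [n] gives both $n > L^{1/e}$ and $n \ge 1$; then $z \ge n$
   yields $z^e > L$. *)
pose L := 2 ^+ m * (`|K| + 1).
have L0 : 0 < L by rewrite mulr_gt0 ?exprn_gt0// ltr_wpDl.
pose n := (Num.truncn (L `^ e^-1)).+1.
exists n => //; set z : R := 1 + n%:R ^+ 2.
have z0 : 0 < z by rewrite ltr_pwDl// sqr_ge0.
have -> : (@japanese R n%:Z `^ (- s)) ^+ 2 = z `^ (- s).
  rewrite /japanese -powR_mulrn ?powR_ge0// -!powRrM; congr (_ `^ _).
  by field.
have Lz : L < z `^ e.
  rewrite -[ltLHS](@powRr1 _ L) ?ltW// -(@mulVf _ e) ?gt_eqF// powRrM.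
  apply: gt0_ltr_powR; rewrite ?nnegrE ?powR_ge0 ?ltW//.
  apply: (@lt_le_trans _ _ n%:R); first exact: truncnS_gt.
  apply: (@le_trans _ _ (n%:R ^+ 2)); last by rewrite lerDr.
  by rewrite ler_eXnr// ler1n.
have z2 : (z / 2) ^+ m <= n%:R ^+ (2 * m).
  rewrite exprM; apply: lerXn2r; rewrite ?nnegrE ?sqr_ge0 ?divr_ge0 ?(ltW z0)//.
  rewrite ler_pdivrMr// mulr_natr mulr2n lerD2r expr_ge1//.
  by rewrite ler1n.
apply: (@lt_le_trans _ _ ((z / 2) ^+ m * z `^ (- s))); last first.
  by rewrite ler_wpM2r ?powR_ge0.
rewrite expr_div_n -powR_mulrn ?ltW// mulrAC -powRD; last by rewrite gt_eqF ?implybT.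
rewrite ltr_pdivlMr ?exprn_gt0//; apply: le_lt_trans Lz.
rewrite /L mulrC ler_pM2l ?exprn_gt0//.
by rewrite (le_trans (ler_norm _))// lerDl.
Qed.

(** * A cubic equation and its plane waves *)

Definition cubic_order (j i : nat) : nat := if i == 0%N then (2 * (j - 1))%N else 0%N.

(* The nonlinearity (-1)^(j-1) (d_x^(2j-2) u) conj(u) u: the sign cancels the one
   which the derivatives produce on e^{ikx}. *)
Definition cubic_coeff (j : nat) : nls_coeff R j := fun k alpha b =>
  if [&& k == 1%N, [forall i, alpha i == cubic_order j i :> nat] &
    [forall i, b i == (i != 1%N :> nat)]] then (-1) ^+ (j - 1) else 0.

Lemma nls_nonlinearity_cubic (j : nat) f x : (0 < j)%N ->
  nls_nonlinearity (cubic_coeff j) f x =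
  (-1) ^+ (j - 1) * (cderiven (2 * (j - 1)) f x * ((f x)^*)%C * f x).
Proof.
move=> j0; rewrite /nls_nonlinearity big_ltn//.
rewrite [X in _ + X]big_nat_cond [X in _ + X]big1 ?addr0; last first.
  move=> k /andP[/andP[k2 _] _]; rewrite big1// => b _; rewrite big1// => alpha _.
  by rewrite /cubic_coeff gtn_eqF//= mul0r.
have ltj i : (cubic_order j i < 2 * (j - 1) + 1)%N.
  by rewrite /cubic_order; case: ifP => _; rewrite addn1.
(* [alpha0] and [b0] are the only indices with a nonzero coefficient: all derivatives fall on factor
   0, and factor 1 is the conjugated one. *)
pose alpha0 : multi j 1 := [ffun i : 'I_(2 * 1 + 1) => Ordinal (ltj i)].
pose b0 : signs 1 := [ffun i : 'I_(2 * 1 + 1) => i != 1%N :> nat].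
pose i0 := @Ordinal (2 * 1 + 1) 0 isT; pose i1 := @Ordinal (2 * 1 + 1) 1 isT.
pose i2 := @Ordinal (2 * 1 + 1) 2 isT.
(* Stated for any monoid law, since it expands both the sum $|\alpha|$ and the product of the three
   factors. *)
have ord3 (T : Type) (idx : T) (op : Monoid.law idx) (F : 'I_(2 * 1 + 1) -> T) :
    \big[op/idx]_i F i = op (F i0) (op (F i1) (F i2)).
  transitivity (\big[op/idx]_(i < 3) F i); first by [].
  rewrite !big_ord_recl big_ord0 Monoid.mulm1.
  by congr (op (F _) (op (F _) (F _))); apply/val_inj.
rewrite (bigD1 b0)//= [X in _ + X]big1 ?addr0; last first.
  move=> b b_neq; rewrite big1// => alpha _; rewrite /cubic_coeff.
  case: ifP => [/and3P[_ _ /forallP bE]|_]; last by rewrite mul0r.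
  by case/eqP: b_neq; apply/ffunP => i; rewrite ffunE; exact/eqP.
rewrite (bigD1 alpha0)/=; last by rewrite ord3 !ffunE /= /cubic_order /= !addn0.
rewrite [X in _ + X]big1 ?addr0; last first.
  move=> alpha /andP[_ alpha_neq]; rewrite /cubic_coeff.
  case: ifP => [/and3P[_ /forallP aE _]|_]; last by rewrite mul0r.
  case/eqP: alpha_neq; apply/ffunP => i; rewrite ffunE; apply/val_inj/eqP.
  exact: aE.
rewrite ord3 !ffunE /= /cubic_coeff ifT; last first.
  by rewrite eqxx /=; apply/andP; split; apply/forallP => i; rewrite ffunE.
by rewrite rmorphXn rmorphN1 -[in RHS]mulrA.
Qed.

Definition plane_wave (A w k t x : R) : C := A%:C%C * cexpi (k * x) * cexpi (w * t).

Lemma plane_waveE (A w k t : R) :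
  plane_wave A w k t = fun x => (A%:C%C * cexpi (w * t)) * cexpi (k * x).
Proof. by apply/funext => x; rewrite /plane_wave mulrAC. Qed.

(** As $|U|^2 = A^2$ is constant, every term of the equation is a real multiple of $U$, and what
    remains is the dispersion relation $w - k^{2j} = k^{2(j-1)} A^2$. *)
Lemma plane_wave_solution (j : nat) (n : int) (A T : R) (k := n%:~R) : (0 < j)%N ->
  classical_solution (cubic_coeff j) T
    (plane_wave A (- (k ^+ (2 * j) + k ^+ (2 * (j - 1)) * A ^+ 2)) k).
Proof.
move=> j0; set w := k ^+ _ + _; split.
- by move=> m; exact: jointC_wave.
- move=> t _ x; rewrite /plane_wave; congr (_ * _ * _); exact: periodic_cexpi.
move=> t x _; rewrite nls_nonlinearity_cubic//.
set U := plane_wave A (- w) k t x.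
have UU : (U^*)%C * U = (A ^+ 2)%:C%C.
  have conjM (a b : C) : conjc (a * b) = conjc a * conjc b by exact: rmorphM.
  rewrite /U /plane_wave !conjM -!cexpiN.
  transitivity (A%:C%C ^+ 2 * (cexpi (k * x) * cexpi (- (k * x))) *
      (cexpi (- w * t) * cexpi (- (- w * t))) : C); first by rewrite conjc_real; ring.
  by rewrite !cexpiMN !mulr1 rmorphXn.
have -> : 'i%C * cderive ((plane_wave A (- w) k)^~ x) t = w%:C%C * U.
  have iiw : 'i%C * ('i%C * (- w)%:C%C) = w%:C%C by simpc.
  by rewrite /U /plane_wave cderive_wave 2!mulrA iiw -!mulrA.
have even m : cderiven (2 * m) (plane_wave A (- w) k t) x =
    ((-1) ^+ m * k ^+ (2 * m))%:C%C * U.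
  by rewrite plane_waveE cderiven_wave_even /U plane_waveE.
have wE : w - k ^+ (2 * j) = k ^+ (2 * (j - 1)) * A ^+ 2 by rewrite /w addrC addKr.
(* From here on only [wE] is needed about [w]: both sides are real scalars times [U], and the powers
   of $-1$ cancel in pairs. *)
clearbody U w; rewrite !even -!mulrA UU.
transitivity ((w + (-1) ^+ j.+1 * ((-1) ^+ j * k ^+ (2 * j)))%:C%C * U).
  by rewrite rmorphD !rmorphM !rmorphXn rmorphN1 mulrDl -!mulrA.
transitivity (((-1) ^+ (j - 1) * ((-1) ^+ (j - 1) * k ^+ (2 * (j - 1))) * A ^+ 2)%:C%C * U);
  last by rewrite !rmorphM !rmorphXn rmorphN1 [U * _]mulrC -!mulrA.
congr (_%:C%C * _).
have -> : (-1) ^+ j.+1 * ((-1) ^+ j * k ^+ (2 * j)) = - k ^+ (2 * j).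
  by rewrite exprS mulrA -[_ * (-1) ^+ j]mulrA -expr2 sqrr_sign mulr1 mulN1r.
by rewrite mulrA -[X in X * k ^+ _]expr2 sqrr_sign mul1r wE.
Qed.

Lemma fourier_sub (u v : test R -> C) (m : int) :
  fourier (fun phi => u phi - v phi) m = fourier u m - fourier v m.
Proof. exact: mulrBl. Qed.

Lemma hatdist_wave (s : R) (r : \bar R) (u v : hatH s r) (l m : C) (n : int) :
  (1 <= r)%E ->
  represents (sval u) (fun x => l * cexpi (n%:~R * x)) ->
  represents (sval v) (fun x => m * cexpi (n%:~R * x)) ->
  hatdist u v = (japanese n `^ s * normc (l - m))%:E.
Proof.
move=> r1 uE vE; apply: hatnorm_single => // q.
rewrite fourier_sub (fourier_wave _ _ _ uE) (fourier_wave _ _ _ vE).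
by case: eqP => // _; rewrite subrr.
Qed.

End PlaneWaves.

Theorem theorem3p9 (R : realType) (j : nat) (r : \bar R) (s : R) :
  (2 <= j)%N -> (1 <= r)%E -> s < j%:R - 1 ->
  exists c : nls_coeff R j,
    forall T : R, 0 < T ->
    forall S : hatH s r -> R -> hatH s r,
      flow_map c T S -> ~ unif_cont_on_bounded T S.
Proof.
move=> j2 r1 sj; have j0 : (0 < j)%N by exact: ltnW.
exists (cubic_coeff j) => T T0 S flowS ucS.
(* Uniform continuity is refuted on the closed unit ball with [e] equal to 1, which the final
   distance [1 + b] reaches because [b] is nonnegative. *)
have B_bounded : hat_bounded [set u : hatH s r | (hatnorm s r (sval u) <= 1%:E)%E].
  by exists 1.
have [d d0 dist_lt] := ucS _ _ B_bounded ltr01.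
have [b [b0 b1 bd]] : exists b : R, [/\ 0 <= b, b < 1 & 1 - b < d].
  (* Half of the minimum makes [1 - b] strictly less than [d]; the cap at 1 keeps [b]
     nonnegative. *)
  exists (1 - Num.min 1 d / 2).
  have : 0 < Num.min 1 d by rewrite lt_min ltr01.
  have : Num.min 1 d <= d by rewrite ge_min lexx orbT.
  have : Num.min 1 d <= 1 by rewrite ge_min lexx.
  by move=> *; split; lra.
have b2 : 0 < 1 - b ^+ 2 by rewrite subr_gt0 expr_lt1.
have sj1 : s < (j - 1)%:R by rewrite natrB.
(* The threshold is chosen so that [K] above it puts the time $\pi / (K (1 - b^2))$ inside the
   interval $(0, T)$. *)
have [n n0 n_large] := frequency_growth _ _ (pi / (T * (1 - b ^+ 2))) sj1.
set J := japanese n%:Z `^ (- s) in n_large.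
have jn0 : 0 < @japanese R n%:Z by rewrite powR_gt0// ltr_pwDl// sqr_ge0.
have J0 : 0 < J by rewrite powR_gt0.
have Js : japanese n%:Z `^ s * J = 1.
  by rewrite -powRD ?subrr ?powRr0// (gt_eqF jn0) implybT.
set K := n%:R ^+ _ * J ^+ 2 in n_large.
have K0 : 0 < K by apply: lt_trans n_large; rewrite divr_gt0 ?pi_gt0// mulr_gt0.
pose k : R := n%:Z%:~R.
pose w (a : R) : R := - (k ^+ (2 * j) + k ^+ (2 * (j - 1)) * (a * J) ^+ 2).
have dataP (a : R) : 0 <= a -> hatnorm s r (wave_dist (a * J)%:C%C k) = a%:E.
  move=> a0; rewrite (hatnorm_single _ _ _ _ _ r1 (fourier_wave _ _ _ (wave_distP _ k))).
  by rewrite normc_real ?mulr_ge0 ?(ltW J0)// mulrCA Js mulr1.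
have data_fin (a : R) : 0 <= a -> (hatnorm s r (wave_dist (a * J)%:C%C k) < +oo)%E.
  by move=> /dataP ->; exact: ltry.
pose data (a : R) (a0 : 0 <= a) : hatH s r := 
  exist (fun u : pdist R => (hatnorm s r u < +oo)%E) _ (data_fin a a0).
(* The plane wave is a classical solution whose value at time 0 represents [data a a0], so
   [flow_map] determines what [S] does to this datum. *)
have flow_data (a : R) (a0 : 0 <= a) t : `|t| < T ->
    represents (sval (S (data a a0) t)) (plane_wave (a * J) (w a) k t).
  apply: flowS; first exact: plane_wave_solution.
  by rewrite plane_waveE mulr0 cexpi0 mulr1; exact: wave_distP.
pose u0 := data 1 ler01; pose v0 := data b b0.
pose t := pi / (K * (1 - b ^+ 2)).
have Kb0 : 0 < K * (1 - b ^+ 2) by exact: mulr_gt0.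
have Tb0 : 0 < T * (1 - b ^+ 2) by exact: mulr_gt0.
have t0 : 0 < t by rewrite divr_gt0 ?pi_gt0.
have tT : `|t| < T.
  rewrite gtr0_norm// /t ltr_pdivrMr//.
  by rewrite mulrCA -ltr_pdivrMr.
(* The linear parts $k^{2j}$ cancel, leaving $w_b - w_1 = K (1 - b^2)$ for the signed frequencies
   [w]. *)
have phase : w b * t = w 1 * t + pi.
  have Kt : K * (1 - b ^+ 2) * t = pi by rewrite /t mulrC divfK ?gt_eqF.
  by rewrite -Kt /w /K /k; ring.
have dist0 : hatdist u0 v0 = (1 - b)%:E.
  rewrite (hatdist_wave s r u0 v0 _ _ n%:Z r1 (wave_distP _ k) (wave_distP _ k)).
  rewrite -rmorphB -mulrBl normc_real ?mulr_ge0 ?subr_ge0 ?(ltW b1) ?(ltW J0)//.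
  by rewrite mulrCA Js mulr1.
have distt : hatdist (S u0 t) (S v0 t) = (1 + b)%:E.
  have := flow_data b b0 t tT; have := flow_data 1 ler01 t tT.
  rewrite !plane_waveE => u0E v0E; rewrite (hatdist_wave _ _ _ _ _ _ n%:Z r1 u0E v0E).
  (* The phases being opposite, subtracting the two waves adds their amplitudes [J] and [b * J]. *)
  rewrite phase cexpiDpi mulrN opprK -mulrDl -rmorphD -mulrDl normcM normc_cexpi mulr1.
  by rewrite normc_real ?mulr_ge0 ?addr_ge0 ?(ltW J0)// mulrCA Js mulr1.
have := dist_lt u0 v0; rewrite dist0 lte_fin => /(_ _ _ bd); rewrite /= !dataP ?lee_fin//.
move=> /(_ (lexx _) (ltW b1)); apply/negP; rewrite -leNgt.
apply: (@le_trans _ _ (1 + b)%:E); first by rewrite lee_fin lerDl.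
by rewrite -distt; apply: ereal_sup_ubound; exists t.
Qed.
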